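(* Let $\mu:\mathcal{P}(\mathcal{C})\to L^*$ be a capacity and $f:\mathcal{C}\to L^*$ an input vector. Then $\int_{\mathrm{DPR},\mu}^{\otimes_D} f>_\ell *$ if and only if $\mu(\{i\in\mathcal{C}\mid f_i>_\ell *\})>_\ell *$.
   Context: Residuated lattice: $L=(L,\wedge,\vee,\otimes,\to,0,1)$ is a linearly ordered residuated lattice: $(L,\wedge,\vee,0,1)$ is a linearly ordered lattice with bottom $0$ and top $1$ ($0\neq 1$), $(L,\otimes,1)$ is a commutative monoid, and $\alpha\otimes\beta\le\gamma$ iff $\alpha\le\beta\to\gamma$. The underlying ordered set of $L$ is either a closed real interval $[a,b]$ with $a<b$ or a finite subset of $[a,b]$ containing $a$ and $b$ (with $0,1$ denoting the bottom and top elements). Standing assumption: $L$ has no zero divisors with respect to $\otimes$, i.e. $\alpha\otimes\beta=0$ implies $\alpha=0$ or $\beta=0$. Dragonfly algebra: $L^*=L\cup\{*\}$ with $*\notin L$ (the ''unknown value''). Its linear order $\le_\ell$ extends the order of $L$ by $0<_\ell *<_\ell\alpha$ for all $\alpha\in L\setminus\{0\}$; $\wedge_D,\vee_D$ are the minimum and maximum with respect to $\le_\ell$, and $\bigwedge_D,\bigvee_D$ denote infimum and supremum with respect to $\le_\ell$ (with $\bigwedge_D\emptyset=1$, $\bigvee_D\emptyset=0$). The multiplication $\otimes_D$ on $L^*$ is: $\alpha\otimes_D\beta=\alpha\otimes\beta$ for $\alpha,\beta\in L$; $*\otimes_D 0=0\otimes_D *=0$; $*\otimes_D\alpha=\alpha\otimes_D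 *=*$ for $\alpha\in L\setminus\{0\}$; $*\otimes_D *=*$. $\mathcal{C}=\{1,\dots,n\}$ is a finite non-empty set with power set $\mathcal{P}(\mathcal{C})$. An input vector is a map $f:\mathcal{C}\to L^*$, $f_i=f(i)$. A capacity is a map $\mu:\mathcal{P}(\mathcal{C})\to L^*$ with $\mu(\emptyset)=0$, $\mu(\mathcal{C})=1$, and $A\subseteq B\Rightarrow\mu(A)\le_\ell\mu(B)$. The multiplication-based qualitative integral is $$\int_{\mathrm{DPR},\mu}^{\otimes_D} f=\bigvee_{D,\,A\subseteq\mathcal{C}}\Big(\mu(A)\otimes_D\bigwedge_{D,\,i\in A}f_i\Big).$$ *)

(* Defs.v *)
From HB Require Import structures.
From mathcomp Require Import all_boot all_order all_algebra.
From mathcomp Require Import all_classical all_reals.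

Set Implicit Arguments.
Unset Strict Implicit.
Unset Printing Implicit Defensive.

Import Order.TTheory.
Local Open Scope order_scope.

(* A closed real interval [lo, hi], or a finite subset of it containing both
   endpoints, with the order inherited from R. *)
Record realChain (R : realType) := RealChain {
  lo : R;
  hi : R;
  elems : set R;
  lo_lt_hi : lo < hi;
  elemsP : elems = `[lo, hi]%classic \/
    [/\ finite_set elems, (elems `<=` `[lo, hi])%classic,
        elems lo & elems hi]
}.

Record chain (R : realType) (C : realChain R) := Chain {
  chain_val : R;
  chain_valP : chain_val \in elems C
}.

HB.instance Definition _ (R : realType) (C : realChain R) :=
  [isSub for @chain_val R C].
HB.instance Definition _ (R : realType) (C : realChain R) :=
  [Choice of chain C by <:].
HB.instance Definition _ (R : realType) (C : realChain R) :=
  [SubChoice_isSubOrder of chain C by <: with Order.default_display].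

Section ChainBounds.
Context {R : realType} {C : realChain R}.

Lemma elems_itv (x : R) : elems C x -> lo C <= x <= hi C.
Proof.
case: (elemsP C) => [->|[_ sub _ _] /sub] /=; by rewrite in_itv.
Qed.

Lemma mem_lo : lo C \in elems C.
Proof.
apply/mem_set; case: (elemsP C) => [->|[]//] /=.
by rewrite in_itv /= lexx ltW // lo_lt_hi.
Qed.

Lemma mem_hi : hi C \in elems C.
Proof.
apply/mem_set; case: (elemsP C) => [->|[]//] /=.
by rewrite in_itv /= lexx ltW // lo_lt_hi.
Qed.

Definition chain_bot : chain C := Chain mem_lo.
Definition chain_top : chain C := Chain mem_hi.

Lemma chain_le0x (x : chain C) : chain_bot <= x.
Proof. by rewrite leEsub; have /set_mem/elems_itv/andP[] := valP x. Qed.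

Lemma chain_lex1 (x : chain C) : x <= chain_top.
Proof. by rewrite leEsub; have /set_mem/elems_itv/andP[] := valP x. Qed.

HB.instance Definition _ := Order.hasBottom.Build _ (chain C) chain_le0x.
HB.instance Definition _ := Order.hasTop.Build _ (chain C) chain_lex1.

Lemma chain_top_neq_bot : (\top : chain C) != \bot.
Proof. by rewrite -(inj_eq val_inj) /= gt_eqF // lo_lt_hi. Qed.

End ChainBounds.

Record residuated d (L : tbOrderType d) := Residuated {
  tens : L -> L -> L;
  resid : L -> L -> L;
  tensA : associative tens;
  tensC : commutative tens;
  tens1x : left_id \top tens;
  residP : forall x y z : L, (tens x y <= z) = (x <= resid y z)
}.

Definition no_zero_divisors d (L : tbOrderType d) (T : residuated L) : Prop :=
  forall x y : L, tens T x y = \bot -> x = \bot \/ y = \bot.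

(* [None] is the unknown value [*], placed just above 0 and below every nonzero
   element. *)
Definition dragonfly (R : realType) (C : realChain R) := option (chain C).

HB.instance Definition _ (R : realType) (C : realChain R) :=
  Choice.on (dragonfly C).

Section Dragonfly.
Context {R : realType} {C : realChain R}.
Implicit Types u v w : dragonfly C.

Definition star : dragonfly C := None.

Definition dle u v : bool :=
  match u, v with
  | Some x, Some y => x <= y
  | Some x, None => x == \bot
  | None, Some y => y != \bot
  | None, None => true
  end.

Lemma dle_refl : reflexive dle.
Proof. by case=> [x|] /=. Qed.

Lemma dle_anti : antisymmetric dle.
Proof.
case=> [x|] [y|] //=; first by move/le_anti=> ->.
  by case: (x == \bot).
by case: (y == \bot).
Qed.

Lemma dle_trans : transitive dle.
Proof.
case=> [y|] [x|] [z|] //=; first exact: le_trans.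
- by move=> + /eqP y0; rewrite y0 lex0.
- by move=> y0 yz; apply: contra y0 => /eqP z0; rewrite -lex0 -z0.
- by move=> /eqP-> _; exact: le0x.
Qed.

Lemma dle_total : total dle.
Proof. by case=> [x|] [y|] //=; rewrite ?le_total ?orbN ?orNb. Qed.

HB.instance Definition _ :=
  Order.Le_isPOrder.Build Order.default_display (dragonfly C)
    dle_refl dle_anti dle_trans.
HB.instance Definition _ :=
  Order.POrder_isTotal.Build Order.default_display (dragonfly C) dle_total.

Lemma dle0x u : (Some \bot : dragonfly C) <= u.
Proof. by case: u => [x|]; rewrite /Order.le /= ?le0x. Qed.

Lemma dlex1 u : u <= (Some \top : dragonfly C).
Proof. by case: u => [x|]; rewrite /Order.le /= ?lex1 ?chain_top_neq_bot. Qed.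

HB.instance Definition _ := Order.hasBottom.Build _ (dragonfly C) dle0x.
HB.instance Definition _ := Order.hasTop.Build _ (dragonfly C) dlex1.

Definition dtens (T : residuated (chain C)) u v : dragonfly C :=
  match u, v with
  | Some x, Some y => Some (tens T x y)
  | Some x, None | None, Some x => if x == \bot then Some \bot else star
  | None, None => star
  end.

Definition capacity n (mu : {set 'I_n} -> dragonfly C) : Prop :=
  [/\ mu finset.set0 = \bot, mu [set: 'I_n] = \top &
      forall A B : {set 'I_n}, A \subset B -> mu A <= mu B].

Definition dpr_integral (T : residuated (chain C)) n
    (mu : {set 'I_n} -> dragonfly C) (f : 'I_n -> dragonfly C) : dragonfly C :=
  \join_(A : {set 'I_n}) dtens T (mu A) (\meet_(i in A) f i).

End Dragonfly.

Arguments star {R C}.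

(* Main.v *)
Require Import Defs.
From mathcomp Require Import all_boot all_order all_algebra.
From mathcomp Require Import all_classical all_reals.

(** The test [star < _] is a morphism from the chain [dragonfly C] to the
    booleans: the order being total, it turns joins into disjunctions and meets
    into conjunctions, and the absence of zero divisors makes it turn the
    product into a conjunction as well ([lt_star_dtens]).  Applied to the
    integral, it yields the condition that some set [A] satisfies both
    [star < mu A] and [star < f i] for all [i] in [A].  The largest set meeting
    the second requirement is [[set i | star < f i]], and since [mu] is
    monotone, that set meets the first one as soon as some [A] does. *)

Import Order.TTheory.
Local Open Scope order_scope.

Section LtStar.
Context {R : realType} {C : realChain R}.
Implicit Types (x y : chain C) (u v : dragonfly C) (T : residuated (chain C)).

Lemma lt_star_Some x : (star < (Some x : dragonfly C)) = (x != \bot).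
Proof. by rewrite ltNge /Order.le /=. Qed.

Lemma lt_star_top : star < (\top : dragonfly C).
Proof. by rewrite (lt_star_Some \top) chain_top_neq_bot. Qed.

Lemma lt_star_joins (I : finType) (P : pred I) (F : I -> dragonfly C) :
  (star < \join_(i | P i) F i) = [exists (i | P i), star < F i].
Proof.
rewrite -big_orE.
by apply: (big_morph (<%O star)) => [u v|]; rewrite /= ?ltxU ?ltx0.
Qed.

Lemma lt_star_meets (I : finType) (P : pred I) (F : I -> dragonfly C) :
  (star < \meet_(i | P i) F i) = [forall (i | P i), star < F i].
Proof.
rewrite -big_andE.
by apply: (big_morph (<%O star)) => [u v|]; rewrite /= ?ltxI ?lt_star_top.
Qed.

(** Residuation forces the bottom to be absorbing: [\bot] lies below the
    residual [x -> \bot]. *)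
Lemma tens0x T : left_zero \bot (tens T).
Proof. by move=> x; apply/eqP; rewrite -lex0 residP le0x. Qed.

Lemma tens_eq0 T x y : no_zero_divisors T ->
  (tens T x y == \bot) = (x == \bot) || (y == \bot).
Proof.
move=> T_nzd; apply/eqP/orP => [/T_nzd[]->|[]/eqP->]; rewrite ?eqxx; auto.
  exact: tens0x.
by rewrite tensC tens0x.
Qed.

(** On [L] this is the absence of zero divisors; a product involving [star]
    is either [star] or bottom. *)
Lemma lt_star_dtens T u v : no_zero_divisors T ->
  (star < dtens T u v) = (star < u) && (star < v).
Proof.
have ltNone : (star < (None : dragonfly C)) = false by exact: ltxx.
have lt_if x : (star < (if x == \bot then Some \bot else star : dragonfly C))
    = false by case: ifP => _; [exact: ltx0 | exact: ltxx].
move=> T_nzd; case: u v => [x|] [y|]; rewrite ?ltNone ?andbF //=.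
by rewrite !lt_star_Some tens_eq0 // negb_or.
Qed.

End LtStar.

Theorem theorem4 (R : realType) (C : realChain R) (T : residuated (chain C))
    (T_nzd : no_zero_divisors T) (n : nat) (n_gt0 : (0 < n)%N)
    (mu : {set 'I_n} -> dragonfly C) (mu_cap : capacity mu)
    (f : 'I_n -> dragonfly C) :
  star < dpr_integral T mu f <-> star < mu [set i : 'I_n | star < f i]%SET.
Proof.
case: mu_cap => _ _ mu_mono; rewrite /dpr_integral lt_star_joins.
split=> [/existsP[A /=]|mu_gt].
  rewrite lt_star_dtens // lt_star_meets => /andP[muA /forall_inP fA].
  apply: lt_le_trans muA (mu_mono _ _ _).
  by apply/fintype.subsetP => i /fA; rewrite inE.
apply/existsP; exists [set i | star < f i]%SET => /=.
rewrite lt_star_dtens // mu_gt lt_star_meets.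
by apply/forall_inP => i; rewrite inE.
Qed.
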